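(* For all positive integers $g,k$ there exists an integer $d=d(g,k)$ such that, for every finite digraph $G$ of genus $g$, the torsion part of the path cohomology $\mathrm{PH}^k(G,\mathbb Z)$ has exponent at most $d$.
   Context: A digraph $G$ consists of a finite set $V(G)$ of vertices and a set $E(G)\subseteq V(G)\times V(G)$ of edges. The genus of $G$ is the first Betti number of its geometric realization, the 1-dimensional CW complex with a 0-cell for each vertex and a 1-cell for each edge (attached to the endpoints of the edge). Path (co)homology (Grigor'yan–Lin–Muranov–Yau). Let $\mathcal R_n(G)$ be the free abelian group on tuples $(v_0,\dots,v_n)$ of vertices with $v_i\ne v_{i+1}$ for all $i$ (regular paths), with boundary $\partial(v_0,\dots,v_n)=\sum_{i=0}^n(-1)^i(v_0,\dots,\widehat{v_i},\dots,v_n)$, where tuples having two equal consecutive entries are set to $0$ (and $\partial=0$ on $\mathcal R_0$). Let $\mathcal A_n(G)\subseteq\mathcal R_n(G)$ be the subgroup generated by the allowed paths, i.e. those with $(v_i,v_{i+1})\in E(G)$ for all $i$, and $\Omega_n(G)=\{x\in\mathcal A_n(G):\partial x\in\mathcal A_{n-1}(G)\}$. Then $(\Omega_*(G),\partial)$ is a chain complex, whose homology is the path homology $\mathrm{PH}_*(G,\mathbb Z)$; the path cohomology $\mathrm{PH}^k(G,\mathbb Z)$ is the $k$-th cohomology of the dual cochain complex $\mathrm{Hom}(\Omega_*(G),\mathbb Z)$. *)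

(* Defs.v *)
From HB Require Import structures.
From mathcomp Require Import all_boot all_algebra zify.
From mathcomp Require Import boolp functions.

Set Implicit Arguments.
Unset Strict Implicit.
Unset Printing Implicit Defensive.

Import GRing.Theory.
Local Open Scope ring_scope.

(* Loops and pairs of opposite edges are permitted; each edge, loops included,
   is a separate 1-cell of the geometric realization. *)
Record digraph := Digraph { vertex :> finType; edge : rel vertex }.

Definition arc (G : digraph) := {e : G * G | edge e.1 e.2}.

(* The geometric realization has no cells of dimension above 1, so its first
   homology is the kernel of the cellular boundary map Q^E -> Q^V. *)
Definition cellular_boundary (G : digraph) : 'M[rat]_(#|{: arc G}|, #|G|) :=
  \matrix_(e, v) (((val (enum_val e)).2 == enum_val v)%:R
                  - ((val (enum_val e)).1 == enum_val v)%:R).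

Definition genus (G : digraph) : nat := \rank (kermx (cellular_boundary G)).

Section Faces.
Variable T : eqType.
Implicit Types s t u v : seq T.

Definition regular s := sorted [rel x y | x != y] s.

Definition face (i : nat) s := take i s ++ drop i.+1 s.

Definition incidence s t : int :=
  \sum_(i < size s) (-1) ^+ i *+ (face i s == t).

Lemma size_face i s : (i < size s)%N -> size (face i s) = (size s).-1.
Proof. by move=> lt_is; rewrite size_cat size_take size_drop lt_is; lia. Qed.

Lemma nth_face x0 i s k :
  (i < size s)%N -> nth x0 (face i s) k = nth x0 s (bump i k).
Proof.
move=> lt_is; rewrite /face nth_cat size_take lt_is /bump.
case: ltnP => [lt_ki|le_ik]; first by rewrite nth_take.
by rewrite nth_drop; congr nth; lia.
Qed.

Lemma face_face i j s : (i <= j)%N -> (j.+1 < size s)%N ->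
  face j (face i s) = face i (face j.+1 s).
Proof.
move=> le_ij lt_js.
have lt_is : (i < size s)%N by lia.
have x0 : T by case: s lt_js {lt_is} => // x.
have szi := size_face lt_is; have szj := size_face lt_js.
have szij : (j < size (face i s))%N by lia.
have szji : (i < size (face j.+1 s))%N by lia.
apply: (@eq_from_nth _ x0) => [|k _]; last first.
  by rewrite !nth_face //; congr nth; rewrite /bump; lia.
by rewrite (size_face szij) (size_face szji) szi szj.
Qed.

Lemma face_catl s t i : (i < size s)%N -> face i (s ++ t) = face i s ++ t.
Proof.
move=> lt_is; rewrite /face take_cat lt_is drop_cat -catA; congr (_ ++ _).
case: ltnP => // le_si; rewrite (_ : i.+1 = size s); last by lia.
by rewrite subnn drop0 drop_size.
Qed.

Lemma face_catr s t i : face (size s + i) (s ++ t) = s ++ face i t.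
Proof.
rewrite /face take_cat ltnNge leq_addr /= addKn drop_cat ltnNge.
rewrite (leq_trans (leq_addr i _) (leqnSn _)) /= -catA; congr (_ ++ (_ ++ _)).
by congr drop; lia.
Qed.

Lemma regularN_split s : ~~ regular s ->
  exists p a q, s = p ++ a :: a :: q.
Proof.
elim: s => [|a [|b s] IHs] //=; rewrite negb_and negbK.
case: eqVneq => [->|_ /= /IHs[p [c [q ->]]]]; first by exists [::], b, s.
by exists (a :: p), c, q.
Qed.

Lemma regular_repeat p a q : regular (p ++ a :: a :: q) = false.
Proof.
elim: p => [|b [|c p] IHp] //=; rewrite ?eqxx ?andbF //.
by move: IHp; rewrite /regular /= => ->; rewrite andbF.
Qed.

Lemma incidence_irregular s t : ~~ regular s -> regular t -> incidence s t = 0.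
Proof.
case/regularN_split=> p [a [q ->]] t_reg; rewrite /incidence.
rewrite size_cat /= !addnS; set n := (size p + size q)%N.
pose F i : int := (-1) ^+ i *+ (face i (p ++ a :: a :: q) == t).
rewrite -(big_mkord xpredT F).
rewrite (big_cat_nat _ (n := size p)) //=; last by lia.
rewrite big_nat big1 => [|i /andP[_ lt_ip]]; last first.
  rewrite /F face_catl //; case: eqP t_reg => // <-.
  by rewrite regular_repeat.
have lt0 : (size p < n.+2)%N by rewrite /n; lia.
have lt1 : ((size p).+1 < n.+2)%N by rewrite /n; lia.
rewrite add0r (big_ltn lt0) (big_ltn lt1).
rewrite big_nat big1 => [|i /andP[lt_pi lt_in]]; last first.
  rewrite /F -(subnKC (ltnW (ltnW lt_pi))) face_catr.
  have -> : (i - size p = (i - (size p).+2).+2)%N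
    by move: lt_pi; clear; lia.
  by case: eqP t_reg => // <-; rewrite regular_repeat.
have := face_catr p (a :: a :: q) 0; have := face_catr p (a :: a :: q) 1.
rewrite addn0 addn1 addr0 /F => -> ->.
by rewrite /face /= !drop0 exprS mulN1r mulNrn subrr.
Qed.

Lemma sum_incidence_face s t :
  \sum_(i < size s) (-1) ^+ i * incidence (face i s) t = 0.
Proof.
case sz: (size s) => [|n]; first by rewrite big_ord0.
pose F i j : int := (-1) ^+ i * ((-1) ^+ j *+ (face j (face i s) == t)).
have FN i j : (i <= j)%N -> (j < n)%N -> F j.+1 i = - F i j.
  move=> le_ij lt_jn; rewrite /F -face_face ?sz // !mulrnAr -!exprD -mulNrn.
  by rewrite addSn exprS mulN1r addnC.
transitivity (\sum_(i < n.+1) \sum_(j < n) F i j).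
  apply: eq_bigr => i _; rewrite /incidence size_face ?sz //= mulr_sumr.
  by [].
under eq_bigr => i _ do rewrite (bigID (fun j : 'I_n => (i <= j)%N)) /=.
rewrite big_split /= [X in X + _]big_ord_recr /=.
rewrite [X in _ + X + _]big1 => [|j]; last by rewrite leqNgt ltn_ord.
rewrite addr0 [X in _ + X]big_ord_recl [X in _ + (X + _)]big_pred0 // add0r.
rewrite [X in _ + X](_ : _ =
    \sum_(i < n) \sum_(j < n | (i <= j)%N) F j.+1 i); last first.
  rewrite (exchange_big_dep xpredT) //=; apply: eq_bigr => i _.
  by apply: eq_bigl => j; rewrite -ltnNge.
rewrite -big_split big1 // => i _; rewrite -big_split big1 // => j le_ij /=.
by rewrite FN // subrr.
Qed.

End Faces.

Section PathComplex.
Variable G : digraph.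

Definition rpath (n : nat) := {t : n.+1.-tuple G | regular t}.

(* The free abelian group on the regular paths of length n; the coefficient of
   v in x is x v. *)
Definition rchain (n : nat) := {ffun rpath n -> int}.

HB.instance Definition _ n := GRing.Zmodule.on (rchain n).

(* Faces with two equal consecutive entries contribute nothing, as the result
   is only indexed by regular paths. *)
Definition boundary n (x : rchain n.+1) : rchain n :=
  [ffun w : rpath n =>
     \sum_(v : rpath n.+1) incidence (val v) (val w) * x v].

Lemma boundary_is_zmod_morphism n : zmod_morphism (@boundary n).
Proof.
move=> x y; apply/ffunP => w; rewrite !ffunE -sumrB; apply: eq_bigr => v _.
by rewrite !ffunE mulrBr.
Qed.

HB.instance Definition _ n :=
  GRing.isZmodMorphism.Build _ _ (@boundary n) (@boundary_is_zmod_morphism n).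

Lemma sum_incidence2 n (v : rpath n.+2) (w : rpath n) :
  \sum_(u : rpath n.+1) incidence (val v) (val u) * incidence (val u) (val w)
  = 0.
Proof.
transitivity (\sum_(u : n.+2.-tuple G)
                incidence (val v) u * incidence u (val w)).
  rewrite (bigID (fun u : n.+2.-tuple G => regular u)) /=.
  rewrite [X in _ + X]big1 ?addr0 => [|u u_irr]; last first.
    by rewrite [X in _ * X]incidence_irregular ?mulr0 // (valP w).
  rewrite (reindex_omap (val : rpath n.+1 -> _) insub) => [|u u_reg] /=.
    by apply: eq_bigl => u; rewrite (valP u) valK eqxx.
  by rewrite insubT.
rewrite -[RHS](sum_incidence_face (val v) (val w)).
under eq_bigr do rewrite {1}/incidence mulr_suml.
rewrite exchange_big /=; apply: eq_bigr => i _.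
have szf : size (face i (val v)) == n.+2 by rewrite size_face // size_tuple.
rewrite (bigD1 (Tuple szf)) //= eqxx mulr1n big1 ?addr0 // => u.
by rewrite -val_eqE /= eq_sym => /negPf->; rewrite mul0r.
Qed.

Lemma boundaryK n (x : rchain n.+2) : boundary (boundary x) = 0.
Proof.
apply/ffunP => w; rewrite !ffunE.
under eq_bigr do rewrite ffunE mulr_sumr.
rewrite exchange_big big1 //= => v _.
under eq_bigr do rewrite mulrA [_ * incidence _ _]mulrC.
by rewrite -mulr_suml sum_incidence2 mul0r.
Qed.

Definition allowed_path n (v : rpath n) := sorted (@edge G) (val v).

Definition allowed n : {pred rchain n} :=
  fun x => [forall v, (x v != 0) ==> allowed_path v].

Lemma allowed_zmod_closed n : zmod_closed (@allowed n).
Proof.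
split=> [|x y /forallP x_al /forallP y_al].
  by apply/forallP => v; rewrite ffunE eqxx.
apply/forallP => v; rewrite !ffunE; apply/implyP; apply: contraTT => v_al.
have /eqP-> : x v == 0 by apply: contraNT v_al; apply/implyP/x_al.
have /eqP-> : y v == 0 by apply: contraNT v_al; apply/implyP/y_al.
by rewrite subrr eqxx.
Qed.

HB.instance Definition _ n :=
  GRing.isZmodClosed.Build (rchain n) (@allowed n) (@allowed_zmod_closed n).

(* In degree 0 the boundary is 0, so there is no condition on it. *)
Definition in_Omega n : {pred rchain n} :=
  match n with
  | 0 => fun x => x \in @allowed 0
  | m.+1 => fun x => (x \in @allowed m.+1) && (boundary x \in @allowed m)
  end.

Lemma in_Omega_zmod_closed n : zmod_closed (@in_Omega n).
Proof.
case: n => [|n]; first exact: allowed_zmod_closed.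
split=> [|x y /andP[x1 x2] /andP[y1 y2]]; rewrite unfold_in /=.
  by rewrite raddf0 !rpred0.
by rewrite raddfB !rpredB.
Qed.

HB.instance Definition _ n :=
  GRing.isZmodClosed.Build (rchain n) (@in_Omega n)
    (@in_Omega_zmod_closed n).

Definition Omega n := {x : rchain n | x \in @in_Omega n}.

HB.instance Definition _ n := [isSub of Omega n for @sval _ _].
HB.instance Definition _ n := [Choice of Omega n by <:].
HB.instance Definition _ n := [SubChoice_isSubZmodule of Omega n by <:].

Lemma boundary_in_Omega n (x : Omega n.+1) :
  boundary (val x) \in @in_Omega n.
Proof.
case: n x => [|n] [x /= /andP[_ bx_al]] //.
by rewrite unfold_in /= bx_al boundaryK rpred0.
Qed.

Definition Omega_boundary n (x : Omega n.+1) : Omega n :=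
  Sub (boundary (val x)) (boundary_in_Omega x).

Lemma Omega_boundary_is_zmod_morphism n : zmod_morphism (@Omega_boundary n).
Proof. by move=> x y; apply: val_inj; rewrite !raddfB /= !raddfB. Qed.

HB.instance Definition _ n :=
  GRing.isZmodMorphism.Build _ _ (@Omega_boundary n)
    (@Omega_boundary_is_zmod_morphism n).

Lemma Omega_boundaryK n (x : Omega n.+2) :
  Omega_boundary (Omega_boundary x) = 0.
Proof. by apply: val_inj; rewrite /= boundaryK. Qed.

Definition is_additive n : {pred Omega n -> int} :=
  fun f => `[< zmod_morphism f >].

Lemma is_additive_zmod_closed n : zmod_closed (@is_additive n).
Proof.
split=> [|f h /asboolP fB /asboolP hB]; apply/asboolP => x y.
  by rewrite subrr.
by rewrite !fctE fB hB; lia.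
Qed.

HB.instance Definition _ n :=
  GRing.isZmodClosed.Build (Omega n -> int) (@is_additive n)
    (@is_additive_zmod_closed n).

Definition cochain n := {f : Omega n -> int | f \in @is_additive n}.

HB.instance Definition _ n := [isSub of cochain n for @sval _ _].
HB.instance Definition _ n := [Choice of cochain n by <:].
HB.instance Definition _ n := [SubChoice_isSubZmodule of cochain n by <:].

Lemma coboundary_subproof n (f : cochain n) :
  val f \o @Omega_boundary n \in @is_additive n.+1.
Proof.
have /asboolP fB := valP f; apply/asboolP => x y.
by rewrite /comp Omega_boundary_is_zmod_morphism fB.
Qed.

Definition coboundary n (f : cochain n) : cochain n.+1 :=
  Sub (val f \o @Omega_boundary n) (coboundary_subproof f).

Lemma coboundary_is_zmod_morphism n : zmod_morphism (@coboundary n).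
Proof. by move=> f h; exact: val_inj. Qed.

HB.instance Definition _ n :=
  GRing.isZmodMorphism.Build _ _ (@coboundary n)
    (@coboundary_is_zmod_morphism n).

Definition is_cocycle n : {pred cochain n} := fun f => coboundary f == 0.

Lemma is_cocycle_zmod_closed n : zmod_closed (@is_cocycle n).
Proof.
split=> [|f h]; rewrite !unfold_in /is_cocycle ?raddf0 //.
by move=> /eqP f0 /eqP h0; rewrite coboundary_is_zmod_morphism f0 h0 subrr.
Qed.

HB.instance Definition _ n :=
  GRing.isZmodClosed.Build (cochain n) (@is_cocycle n)
    (@is_cocycle_zmod_closed n).

Definition cocycle n := {f : cochain n | f \in @is_cocycle n}.

HB.instance Definition _ n := [isSub of cocycle n for @sval _ _].
HB.instance Definition _ n := [Choice of cocycle n by <:].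
HB.instance Definition _ n := [SubChoice_isSubZmodule of cocycle n by <:].

Definition is_coboundary n : {pred cocycle n} :=
  match n with
  | 0 => fun f => f == 0
  | m.+1 => fun f => `[< exists h : cochain m, coboundary h = val f >]
  end.

Lemma is_coboundary_zmod_closed n : zmod_closed (@is_coboundary n).
Proof.
case: n => [|n]; split=> [|f h]; rewrite !unfold_in //=.
- by move=> /eqP-> /eqP->; rewrite subrr.
- by apply/asboolP; exists 0; rewrite !raddf0.
- move=> /asboolP[f' f'E] /asboolP[h' h'E]; apply/asboolP; exists (f' - h').
  by rewrite coboundary_is_zmod_morphism f'E h'E.
Qed.

HB.instance Definition _ n :=
  GRing.isZmodClosed.Build (cocycle n) (@is_coboundary n)
    (@is_coboundary_zmod_closed n).

(* For a subgroup I of a commutative group, {ideal_quot I} is the quotient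
   group; no ring structure is involved. *)
Definition path_cohomology (n : nat) : zmodType :=
  {ideal_quot (@is_coboundary n)}.

End PathComplex.

Definition torsion (A : zmodType) (a : A) : Prop :=
  exists2 n : nat, (0 < n)%N & a *+ n = 0.

Definition is_exponent (A : zmodType) (S : A -> Prop) (e : nat) : Prop :=
  let kills m := (0 < m)%N /\ forall a, S a -> a *+ m = 0 in
  kills e /\ forall m, kills m -> (e <= m)%N.

(* Main.v *)
From HB Require Import structures.
Require Import Defs.
From mathcomp Require Import all_boot all_order all_algebra.
From mathcomp Require Import boolp zify ring.

(* If a path of length at least 2 occurs in an element of Omega, then each of
   its inner vertices b, between a and d, satisfies a = d, or a -> d, or
   a -> b' -> d for some other b': otherwise the face omitting b is neither
   allowed nor cancelled. So its arcs lie on cycles of length at most 4. Adding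
   such cycles one at a time, each with an arc not covered before, raises the
   rank of their span, so at most 4 g arcs lie on them. Hence in degrees at
   least 2 the complex Omega is supported on at most 8 g vertices, and the
   differential out of such a degree is given by matrices of bounded size with
   bounded entries. There are finitely many of these, and each admits a D
   killing the torsion. In degree 1 there is no torsion: a potential whose
   differences along arcs are divisible by m can be divided by m up to
   rounding. *)

Set Implicit Arguments.
Unset Strict Implicit.
Unset Printing Implicit Defensive.

Import Order.TTheory GRing.Theory Num.Theory.
Local Open Scope ring_scope.
Local Open Scope quotient_scope.

(** * A uniform constant for extending homomorphisms from integer lattices *)

Lemma integral_multiple_mx m n (Q : 'M[rat]_(m, n)) :
  exists (d : nat) (Z : 'M[int]_(m, n)),
    (0 < d)%N /\ d%:R *: Q = map_mx intr Z.
Proof.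
have den_gt0 (q : rat) : (0 < `|denq q|)%N by rewrite absz_gt0 denq_neq0.
exists (\prod_i \prod_j `|denq (Q i j)|)%N.
exists (\matrix_(i, j) (numq (Q i j) *
   (\prod_(i' | i' != i) \prod_j' `|denq (Q i' j')| *
    \prod_(j' | j' != j) `|denq (Q i j')|)%N%:Z)).
split; first by rewrite prodn_gt0 // => i; rewrite prodn_gt0.
apply/matrixP => i j; rewrite !mxE (bigD1 i) //= (bigD1 j) //=.
rewrite !natrM rmorphM /= -[LHS]mulrA [_%:R * _]mulrC.
have -> : (`|denq (Q i j)|%N%:R : rat) = (denq (Q i j))%:~R.
  by rewrite pmulrn gtz0_abs ?denq_gt0.
rewrite numqE -pmulrn natrM; ring.
Qed.

Lemma intr_mx_inj m n :
  injective (map_mx intr : 'M[int]_(m, n) -> 'M[rat]_(m, n)).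
Proof.
move=> A B /matrixP AB; apply/matrixP => i j.
by have := AB i j; rewrite !mxE => /intr_inj.
Qed.

Section UniformLattice.
Variables t s u : nat.
Implicit Types (M : 'M[int]_(t, s)) (N : 'M[int]_(t, u)).

(* A multiple by D of any homomorphism on the lattice of the x M with x N = 0
   extends to the ambient lattice, through y |-> y P K. *)
Definition extends_after M N (D : nat) :=
  exists (K : 'M[int]_t) (P : 'M[int]_(s, t)), K *m N = 0 /\
  forall x : 'rV[int]_t, x *m N = 0 ->
    D%:Z *: (x *m M) = x *m M *m P *m K *m M.

Lemma extends_after_mul M N D D' :
  extends_after M N D -> extends_after M N (D * D').
Proof.
move=> [K [P [KN0 DE]]]; exists K, (D'%:Z *: P); split=> // x xN0.
by rewrite -scalemxAr -!scalemxAl -DE // scalerA mulrC.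
Qed.

(** Over the rationals, let [K] span the left kernel of [N] and let [P] be a pseudo-inverse of
    [K *m M]. If [x *m N = 0], then [x *m M] lies in the row space of [K *m M], where multiplying by
    [P] and then by [K *m M] is the identity. Denominators are cleared first in [K], then in [P];
    the latter give [D]. *)
Lemma extends_after_exists M N :
  exists2 D, (0 < D)%N & extends_after M N D.
Proof.
have [d [K [d_gt0 KE]]] := integral_multiple_mx (kermx (map_mx intr N)).
pose MQ : 'M[rat]_(t, s) := map_mx intr M.
pose KQ : 'M[rat]_t := map_mx intr K.
have [D [P [D_gt0 PE]]] := integral_multiple_mx (pinvmx (KQ *m MQ)).
exists D => //; exists K, P; split.
  apply: intr_mx_inj; rewrite map_mxM map_mx0 -KE -scalemxAl mulmx_ker.
  by rewrite scaler0.
move=> x xN0; apply: intr_mx_inj.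
rewrite map_mxZ !map_mxM -PE -scalemxAr -!scalemxAl; congr (_ *: _).
rewrite -[RHS]mulmxA mulmxKpV // submxMr //.
have <- : (kermx (map_mx intr N : 'M[rat]_(t, u)) :=: KQ)%MS.
  rewrite /KQ -KE; apply: eqmx_sym; apply: eqmx_scale.
  by rewrite pnatr_eq0 -lt0n.
by apply/sub_kermxP; rewrite -map_mxM xN0 map_mx0.
Qed.

Lemma common_multiple (I : finType) (Q : I -> nat -> Prop) :
  (forall i D D', Q i D -> Q i (D * D')%N) ->
  (forall i, exists2 D, (0 < D)%N & Q i D) ->
  exists2 D, (0 < D)%N & forall i, Q i D.
Proof.
move=> QM /(_ _)/cid2-/all_sig2[D D_gt0 QD].
exists (\prod_i D i)%N => [|i]; first by rewrite prodn_gt0.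
by rewrite (bigD1 i) //=; apply: QM.
Qed.

Lemma extends_after_uniform c : exists2 D, (0 < D)%N &
  forall M N,
    (forall i j, `|M i j| <= c%:Z) -> (forall i j, `|N i j| <= c%:Z) ->
  extends_after M N D.
Proof.
(* Entries of absolute value at most [c], shifted by [c], are ordinals, so the pairs of matrices
   form a finite type and [common_multiple] applies. *)
pose dec (a : 'I_(c + c).+1) : int := a%:Z - c%:Z.
pose enc (z : int) : 'I_(c + c).+1 := inord `|z + c%:Z|.
have encK z : `|z| <= c%:Z -> dec (enc z) = z.
  rewrite -abszE => z_le; rewrite /dec /enc inordK; lia.
pose Q (MN : 'M['I_(c + c).+1]_(t, s) * 'M['I_(c + c).+1]_(t, u)) :=
  extends_after (map_mx dec MN.1) (map_mx dec MN.2).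
have [||D D_gt0 QD] := @common_multiple _ Q.
- by move=> MN D D'; apply: extends_after_mul.
- by move=> MN; apply: extends_after_exists.
exists D => // M N M_le N_le; move: (QD (map_mx enc M, map_mx enc N)).
rewrite /Q /= -!map_mx_comp; congr extends_after.
  by apply/matrixP => i j; rewrite mxE /= encK.
by apply/matrixP => i j; rewrite mxE /= encK.
Qed.

End UniformLattice.

Lemma extends_after_bounded b c : exists2 D, (0 < D)%N &
  forall t s u (M : 'M[int]_(t, s)) (N : 'M[int]_(t, u)),
    (t <= b)%N -> (s <= b)%N -> (u <= b)%N ->
    (forall i j, `|M i j| <= c%:Z) -> (forall i j, `|N i j| <= c%:Z) ->
  extends_after M N D.
Proof.
pose Q (tsu : 'I_b.+1 * 'I_b.+1 * 'I_b.+1) D :=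
  forall (M : 'M[int]_(tsu.1.1, tsu.1.2)) (N : 'M[int]_(tsu.1.1, tsu.2)),
    (forall i j, `|M i j| <= c%:Z) -> (forall i j, `|N i j| <= c%:Z) ->
  extends_after M N D.
have [||D D_gt0 QD] := @common_multiple _ Q.
- by move=> tsu D D' QD M N M_le N_le; apply/extends_after_mul/QD.
- by move=> tsu; apply: extends_after_uniform.
exists D => // t s u M N t_le s_le u_le.
pose o k (k_le : (k <= b)%N) : 'I_b.+1 := @Ordinal b.+1 k k_le.
exact: (QD (o t t_le, o s s_le, o u u_le) M N).
Qed.

(** * Sparse vectors in a row space *)

Definition supp (F : fieldType) n (v : 'rV[F]_n) := [set j | v 0 j != 0].

(** Greedy covering: [U] collects the covered columns, and [B] is a subspace of [A] vanishing
    outside [U]. An uncovered [e] comes with a vector nonzero at [e], hence outside [B]; adding it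
    raises the rank of [B] and enlarges [U] by at most [c]. *)
Lemma card_small_supports (F : fieldType) m n c (A : 'M[F]_(m, n))
    (E : {set 'I_n}) :
  (forall e, e \in E ->
     exists v : 'rV_n, [/\ (v <= A)%MS, v 0 e != 0 & (#|supp v| <= c)%N]) ->
  (#|E| <= c * \rank A)%N.
Proof.
move=> E_short.
have: {subset enum E <= E} by move=> e; rewrite mem_enum.
suff cover (es : seq 'I_n) : {subset es <= E} ->
    exists (U : {set 'I_n}) (B : 'M[F]_n),
    [/\ {subset es <= U}, (B <= A)%MS, (#|U| <= c * \rank B)%N &
        forall j (v : 'rV_n), j \notin U -> (v <= B)%MS -> v 0 j = 0].
  case/cover=> U [B [EU BA U_le _]].
  have /subset_leq_card/leq_trans-> // : E \subset U.
    by apply/subsetP => e eE; apply: EU; rewrite mem_enum.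
  by rewrite (leq_trans U_le) // leq_mul2l mxrankS ?orbT.
elim: es => [|e es IHes] sEes.
  exists set0, 0; split=> //; rewrite ?sub0mx ?cards0 //.
  by move=> j v _; rewrite submx0 => /eqP->; rewrite mxE.
have [|U [B [esU BA U_le UB]]] := IHes.
  by move=> e' e'es; apply: sEes; rewrite inE e'es orbT.
have [eU|eU] := boolP (e \in U).
  by exists U, B; split=> // e'; rewrite inE => /predU1P[->|/esU].
have [v [vA ve v_le]] := E_short e (sEes e (mem_head _ _)).
exists (U :|: supp v), (B + v)%MS; split.
- by move=> e'; rewrite !inE => /predU1P[->|/esU->]; rewrite ?ve ?orbT.
- by rewrite addsmx_sub BA.
- have /rank_ltmx lt_rank : (B < B + v)%MS.
    rewrite ltmxE addsmxSl addsmx_sub submx_refl /=.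
    by apply: contra ve => /UB->.
  rewrite (leq_trans (leq_card_setU _ _)) // (leq_trans (leq_add U_le v_le)) //.
  by rewrite -mulnSr leq_mul2l lt_rank orbT.
- move=> j w; rewrite !inE negb_or negbK => /andP[jU /eqP vj].
  case/sub_addsmxP=> [[w1 w2]] ->; rewrite mxE (UB _ _ jU) ?submxMl // add0r.
  by rewrite mxE big_ord1 vj mulr0.
Qed.

Lemma card_suppD (F : fieldType) n (v w : 'rV[F]_n) :
  (#|supp (v + w)| <= #|supp v| + #|supp w|)%N.
Proof.
apply: leq_trans (leq_card_setU _ _); apply: subset_leq_card.
apply/subsetP => j; rewrite !inE mxE; apply: contraR.
by rewrite negb_or !negbK => /andP[/eqP-> /eqP->]; rewrite addr0.
Qed.

Lemma card_suppN (F : fieldType) n (v : 'rV[F]_n) : #|supp (- v)| = #|supp v|.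
Proof. by apply: eq_card => j; rewrite !inE mxE oppr_eq0. Qed.

Lemma card_supp_delta (F : fieldType) n (j : 'I_n) :
  #|supp (delta_mx 0 j : 'rV[F]_n)| = 1%N.
Proof.
rewrite -[RHS](cards1 j); apply: eq_card => i.
by rewrite !inE mxE eqxx; case: (eqVneq i j) => _; rewrite /= ?oner_eq0 ?eqxx.
Qed.

(** * Arcs on short cycles *)

Section ShortCycles.
Local Notation arc := Defs.arc.
Variable G : digraph.

(** Cycles are taken homologically, as sparse rational vectors in the kernel whose rank is the
    genus, so that [card_small_supports] applies. *)
Definition short_arc (e : arc G) :=
  exists v : 'rV[rat]_(#|{: arc G}|),
    [/\ (v <= kermx (cellular_boundary G))%MS, v 0 (enum_rank e) != 0
      & (#|supp v| <= 4)%N].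

Definition short_arcs := [set e | `[< short_arc e >]].

Definition short_vertices : {set G} :=
  [set (val e).1 | e in short_arcs] :|: [set (val e).2 | e in short_arcs].

Lemma card_short_vertices : (#|short_vertices| <= 8 * genus G)%N.
Proof.
have le_arcs : (#|short_arcs| <= 4 * genus G)%N.
  rewrite -(card_imset _ enum_rank_inj).
  apply: card_small_supports => _ /imsetP[e + ->].
  by rewrite inE => /asboolP.
apply: leq_trans (leq_card_setU _ _) _.
apply: leq_trans (leq_add (leq_imset_card _ _) (leq_imset_card _ _)) _.
by rewrite addnn -mul2n -(leq_pmul2l (isT : 0 < 2)%N) mulnA in le_arcs *.
Qed.

Definition arc_vec (e : arc G) : 'rV[rat]_(#|{: arc G}|) :=
  delta_mx 0 (enum_rank e).

Lemma arc_vecE e e' : arc_vec e 0 (enum_rank e') = (e == e')%:R.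
Proof. by rewrite mxE eqxx /= (inj_eq enum_rank_inj) eq_sym. Qed.

Lemma arc_vec_boundary e x : (arc_vec e *m cellular_boundary G) 0 x =
  ((val e).2 == enum_val x)%:R - ((val e).1 == enum_val x)%:R.
Proof. by rewrite -rowE !mxE enum_rankK. Qed.

(* The two arcs together with a parallel path p of at most two other arcs form a
   cycle of length at most four. *)
Lemma parallel_short_arcs a b d (ab : edge a b) (bd : edge b d)
    (e1 := exist _ (a, b) ab : arc G) (e2 := exist _ (b, d) bd : arc G)
    (p : 'rV[rat]_(#|{: arc G}|)) :
    a != b -> (#|supp p| <= 2)%N ->
    p 0 (enum_rank e1) = 0 -> p 0 (enum_rank e2) = 0 ->
    (forall x, (p *m cellular_boundary G) 0 x =
       (d == enum_val x)%:R - (a == enum_val x)%:R) ->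
  {subset [:: a; b; d] <= short_vertices}.
Proof.
move=> ne_ab p_le p1 p2 pE.
have e12 : e1 != e2 by rewrite -val_eqE /= xpair_eqE (negPf ne_ab).
(* The two arcs together have the same boundary as [p], so [c] is a cycle. As [p] vanishes on both
   arcs and they are distinct, each has coefficient 1 in [c]. *)
pose c := arc_vec e1 + arc_vec e2 - p.
have c_ker : (c <= kermx (cellular_boundary G))%MS.
  apply/sub_kermxP/matrixP => i x; rewrite ord1 mulmxBl mulmxDl.
  rewrite [LHS]mxE [X in X + _]mxE [X in _ + X]mxE pE !arc_vec_boundary mxE /=.
  by ring.
have c_le : (#|supp c| <= 4)%N.
  apply: leq_trans (card_suppD _ _) _; rewrite card_suppN.
  rewrite (leq_add (n1 := 2) (n2 := 2)) //.
  by apply: leq_trans (card_suppD _ _) _; rewrite !card_supp_delta.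
have cE e : p 0 (enum_rank e) = 0 ->
    c 0 (enum_rank e) = (e1 == e)%:R + (e2 == e)%:R.
  move=> pe; rewrite [LHS]mxE [X in X + _]mxE [X in _ + X]mxE pe oppr0 addr0.
  by rewrite !arc_vecE.
have s1 : e1 \in short_arcs.
  rewrite inE; apply/asboolP; exists c; split=> //.
  by rewrite cE // eqxx [e2 == _]eq_sym (negPf e12) addr0 oner_eq0.
have s2 : e2 \in short_arcs.
  rewrite inE; apply/asboolP; exists c; split=> //.
  by rewrite cE // eqxx (negPf e12) add0r oner_eq0.
move=> x; rewrite !inE => /or3P[] /eqP->; apply/orP.
- by left; apply/imsetP; exists e1.
- by right; apply/imsetP; exists e1.
- by right; apply/imsetP; exists e2.
Qed.

(** The parallel path is empty, or the arc from [a] to [d], or the path through [b']. The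
    inequalities keep its arcs different from the two given ones. *)
Lemma triple_short a b d : edge a b -> edge b d -> a != b -> b != d ->
    [\/ a = d, edge a d | exists b', [/\ b' != b, edge a b' & edge b' d]] ->
  {subset [:: a; b; d] <= short_vertices}.
Proof.
move=> ab bd ne_ab ne_bd [ad|ad|[b' [ne_b ab' bd']]].
- apply: (@parallel_short_arcs _ _ _ ab bd 0) => //; rewrite ?mxE //.
    by rewrite (@eq_card0 _ (supp _)) // => j; rewrite !inE mxE eqxx.
  by move=> x; rewrite mul0mx mxE ad subrr.
- pose e : arc G := exist _ (a, d) ad.
  apply: (@parallel_short_arcs _ _ _ ab bd (arc_vec e)) => //.
  + by rewrite card_supp_delta.
  + by rewrite arc_vecE -val_eqE /= xpair_eqE eqxx [d == b]eq_sym (negPf ne_bd).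
  + by rewrite arc_vecE -val_eqE /= xpair_eqE (negPf ne_ab).
  + by move=> x; rewrite arc_vec_boundary.
- pose e1 : arc G := exist _ (a, b') ab'.
  pose e2 : arc G := exist _ (b', d) bd'.
  apply: (@parallel_short_arcs _ _ _ ab bd (arc_vec e1 + arc_vec e2)) => //.
  + by apply: leq_trans (card_suppD _ _) _; rewrite !card_supp_delta.
  + rewrite [LHS]mxE !arc_vecE -!val_eqE /= !xpair_eqE (negPf ne_b).
    by rewrite [d == b]eq_sym (negPf ne_bd) !andbF addr0.
  + rewrite [LHS]mxE !arc_vecE -!val_eqE /= !xpair_eqE (negPf ne_ab).
    by rewrite (negPf ne_b) addr0.
  + by move=> x; rewrite mulmxDl mxE !arc_vec_boundary /=; ring.
Qed.

End ShortCycles.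

(** * Supports of elements of Omega *)

Section Supports.
Variable T : eqType.
Implicit Types s : seq T.

(** Adjacent entries of a face are adjacent in [s], except for the pair closing the gap left by the
    omitted entry [i], at positions [i.-1] and [i]. *)
Lemma face_missing_rel (e : rel T) x0 s i j :
    sorted e s -> (j.+2 < size s)%N -> (i < size s)%N ->
    ~~ e (nth x0 (face i s) j) (nth x0 (face i s) j.+1) -> i = j.+1.
Proof.
move=> /(sortedP x0) e_s lt_js lt_is; rewrite !nth_face // /bump => Ne.
apply: contraNeq Ne => ne_ij.
case: (leqP i j) => [le_ij|gt_ij].
  by rewrite (leqW le_ij) !add1n; apply: e_s.
have -> : (i <= j.+1)%N = false by lia.
by rewrite !add0n; apply: e_s; lia.
Qed.

End Supports.

(** Let [a], [b], [d] be the triple. If [a] and [d] differ and there is no arc from [a] to [d], the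
    face [w] omitting [b] is regular but not allowed, so [boundary x] vanishes at [w]. The
    contribution of [v] is nonzero, so another path [u] of the support has the face [w]; it differs
    from [v] only in the vertex replacing [b]. *)
Lemma support_triple (G : digraph) n (x : rchain G n.+2) (v : rpath G n.+2)
    x0 (j : 'I_n.+1) :
    x \in @in_Omega G n.+2 -> x v != 0 ->
  {subset [:: nth x0 (val v) j; nth x0 (val v) j.+1; nth x0 (val v) j.+2] <=
    short_vertices G}.
Proof.
move=> /andP[/forallP x_al /forallP bx_al] xv.
have e_v := sortedP x0 (implyP (x_al v) xv).
have v_reg := valP v; have sz_v : size (val v) = n.+3 by rewrite size_tuple.
have lt_j := ltn_ord j.
have lt2 : (j.+2 < size (val v))%N by rewrite sz_v.
have lt1 : (j.+1 < size (val v))%N by lia.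
set a := nth _ _ _; set b := nth _ _ _; set d := nth _ _ _.
apply: triple_short.
- exact: e_v.
- exact: e_v.
- exact: (sortedP x0 v_reg j lt1).
- exact: (sortedP x0 v_reg j.+1 lt2).
have [ad|ne_ad] := eqVneq a d; first by constructor 1.
have [ad|Nad] := boolP (edge a d); first by constructor 2.
constructor 3.
have szf : size (face j.+1 (val v)) == n.+2
  by rewrite size_face // size_tuple.
have fj : nth x0 (face j.+1 (val v)) j = a by rewrite nth_face // /bump ltnn.
have fj1 : nth x0 (face j.+1 (val v)) j.+1 = d.
  by rewrite nth_face // /bump leqnn.
have f_reg : regular (Tuple szf).
  apply/(sortedP x0) => k; rewrite (eqP szf) => lt_k; apply: contraT => eq_k.
  have eq_jk : j.+1 = k.+1.
    by apply: (face_missing_rel v_reg _ lt1 eq_k); rewrite size_tuple.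
  by move: eq_k; rewrite -(succn_inj eq_jk) /= fj fj1 ne_ad.
pose w : rpath G n.+1 := exist _ (Tuple szf) f_reg.
have Nw : boundary x w = 0.
  apply: contraNeq Nad => /(implyP (bx_al w))/(sortedP x0)/(_ j).
  by rewrite size_tuple fj fj1 => ->.
(* The missing arc from [a] to [d] fixes which entry is omitted, so the incidence of [v] with [w] is
   a single sign, without cancellation. *)
have unique_face (u : rpath G n.+2) i : x u != 0 -> (i < n.+3)%N ->
    face i (val u) = val w -> i = j.+1.
  move=> xu lt_i uw; apply: (@face_missing_rel _ (@edge G) x0 (val u)).
  - exact: (implyP (x_al u)).
  - by rewrite size_tuple.
  - by rewrite size_tuple.
  - by rewrite uw fj fj1.
have inc_v : incidence (val v) (val w) != 0.
  rewrite /incidence (bigD1 (Ordinal lt1)) //= eqxx big1 => [|i ne_i].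
    by rewrite addr0 signr_eq0.
  case: eqP => // /unique_face eq_i; case/eqP: ne_i; apply: val_inj.
  by rewrite /= eq_i // -[X in (_ < X)%N](size_tuple (val v)).
have [u ne_uv iu] : exists2 u, u != v & incidence (val u) (val w) * x u != 0.
  apply: contrapT => /forall2NP no_u; move/eqP: Nw; apply/negP.
  rewrite ffunE (bigD1 v) //= big1 => [|u ne_u].
    by rewrite addr0 mulf_neq0.
  by have [/(_ ne_u)//|/negP/negPn/eqP] := no_u u.
have [i iw] : exists i : 'I_(size (val u)), face i (val u) == val w.
  apply/existsP; apply: contraNT iu; rewrite negb_exists => /forallP no_i.
  by rewrite /incidence big1 ?mul0r // => i _; rewrite (negPf (no_i i)).
have xu : x u != 0 by apply: contraNneq iu => ->; rewrite mulr0.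
have ij : i = j.+1 :> nat.
  apply: (unique_face u) (eqP iw) => //.
  by rewrite -[X in (_ < X)%N](size_tuple (val u)).
have lt1u : (j.+1 < size (val u))%N by rewrite size_tuple -sz_v.
have fu : face j.+1 (val u) = face j.+1 (val v) by rewrite -{1}ij; apply/eqP.
have nth_u k : k != j.+1 -> nth x0 (val u) k = nth x0 (val v) k.
  move=> ne_k; have /unbumpK <- : k \in predC1 j.+1 by [].
  by rewrite -!nth_face // fu.
have e_u := sortedP x0 (implyP (x_al u) xu).
exists (nth x0 (val u) j.+1); split.
- apply: contraNneq ne_uv => eq_b; apply/eqP/val_inj/val_inj.
  apply: (@eq_from_nth _ x0) => [|k _]; first by rewrite !size_tuple.
  by have [->|/nth_u] := eqVneq k j.+1.
- by rewrite -[a]nth_u ?e_u //; lia.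
- by rewrite -[d]nth_u ?e_u ?size_tuple //; lia.
Qed.

Lemma support_short (G : digraph) n (x : rchain G n.+2) (v : rpath G n.+2) :
  x \in @in_Omega G n.+2 -> x v != 0 -> all [in short_vertices G] (val v).
Proof.
move=> x_Om xv; case v_x0 : (val v) => [[|x0 s] sz] //; rewrite -v_x0.
apply/(all_nthP x0) => i; rewrite size_tuple => lt_i.
have triple (j : 'I_n.+1) := @support_triple G n x v x0 j x_Om xv.
(* Position 0 begins the first triple, the last position ends the last triple, and any other is the
   middle of one. *)
case: i lt_i => [|i lt_i].
  by move=> _; apply: (triple ord0); rewrite !inE eqxx.
case: (ltnP i n.+1) => [lt_in|ge_in].
  by apply: (triple (Ordinal lt_in)); rewrite !inE eqxx orbT.
have -> : i.+1 = n.+2 by lia.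
by apply: (triple ord_max); rewrite !inE eqxx !orbT.
Qed.

(** * Chains with prescribed support, in coordinates *)

Section ExtendByZero.
Variables (T : finType) (P : pred T).

Definition ext0 (y : 'rV[int]_(#|{: {v | P v}}|)) : {ffun T -> int} :=
  [ffun v => if insub v is Some r then y 0 (enum_rank r) else 0].

Definition restrict (x : {ffun T -> int}) : 'rV[int]_(#|{: {v | P v}}|) :=
  \row_i x (val (enum_val i)).

Lemma ext0_val y i : ext0 y (val (enum_val i)) = y 0 i.
Proof. by rewrite ffunE valK enum_valK. Qed.

Lemma ext0_out y v : ~~ P v -> ext0 y v = 0.
Proof. by move=> Nv; rewrite ffunE insubN. Qed.

Lemma ext0_is_zmod_morphism : zmod_morphism ext0.
Proof.
move=> x y; apply/ffunP => v; rewrite !ffunE.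
by case: insubP => [r _ _|_]; rewrite ?mxE ?subr0.
Qed.

HB.instance Definition _ :=
  GRing.isZmodMorphism.Build _ _ ext0 ext0_is_zmod_morphism.

Lemma ext0K : cancel ext0 restrict.
Proof. by move=> y; apply/rowP => i; rewrite mxE ext0_val. Qed.

Lemma restrictK (x : {ffun T -> int}) :
  (forall v, x v != 0 -> P v) -> ext0 (restrict x) = x.
Proof.
move=> xP; apply/ffunP => v; have [Pv|Nv] := boolP (P v).
  pose r : {v | P v} := exist _ v Pv.
  by rewrite -[v]/(val r) -[r]enum_rankK ext0_val mxE.
by rewrite ext0_out //; apply/esym/eqP; apply: contraR Nv => /xP.
Qed.

Lemma sum_ext0 (F : T -> int) y :
  \sum_v F v * ext0 y v = \sum_i F (val (enum_val i)) * y 0 i.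
Proof.
rewrite (bigID P) /= [X in _ + X]big1 ?addr0 => [|v Nv]; last first.
  by rewrite ext0_out ?mulr0.
rewrite (reindex_omap (val : {v | P v} -> T) insub) => [|v Pv] /=; last first.
  by rewrite insubT.
rewrite (eq_bigl xpredT) => [|r]; last by rewrite (valP r) valK eqxx.
rewrite (reindex_onto enum_val enum_rank) => [|r _]; last by rewrite enum_rankK.
by apply: eq_big => i; rewrite ?enum_valK ?eqxx // ext0_val.
Qed.

End ExtendByZero.

(** * Bounds on incidence numbers and on numbers of paths *)

Lemma incidence_bound (T : eqType) (s t : seq T) :
  `|incidence s t| <= (size s)%:Z.
Proof.
rewrite /incidence (le_trans (ler_norm_sum _ _ _)) //.
rewrite -[X in (X : nat)%:Z](card_ord (size s)) -[leRHS]natz -sumr_const.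
by apply: ler_sum => i _; rewrite normrMn normrX normrN1 expr1n; case: eqP.
Qed.

(** Letters are coded by their index in [enum W]; the alphabet has size [b.+1] because [inord] needs
    a nonempty ordinal type. *)
Lemma card_words (T : finType) (W : {set T}) n b (P : pred (n.-tuple T))
    (Q : pred {t | P t}) :
  (#|W| <= b)%N -> (forall t, Q t -> all [in W] (val t)) ->
  (#|{: {t | Q t}}| <= b.+1 ^ n)%N.
Proof.
move=> W_le QW.
pose code (t : {t | Q t}) : n.-tuple 'I_b.+1 :=
  map_tuple (fun x => inord (index x (enum W))) (val (val t)).
have code_inj : injective code.
  move=> s t /(congr1 val) /= st; apply/val_inj/val_inj/val_inj.
  apply: (inj_in_map (A := W)) st => [x y xW yW eq_xy||];
    [|exact: QW _ (valP s)|exact: QW _ (valP t)].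
  have idx_lt z : z \in W -> (index z (enum W) < b.+1)%N.
    move=> zW; rewrite ltnS (leq_trans _ W_le) // cardE ltnW // index_mem.
    by rewrite mem_enum.
  have := congr1 val eq_xy; rewrite /= !inordK ?idx_lt // => eq_idx.
  rewrite -[x](@nth_index _ x _ (enum W)) ?mem_enum // eq_idx.
  by rewrite nth_index ?mem_enum.
have := leq_card code code_inj.
by rewrite card_tuple card_ord.
Qed.

(** * Killing torsion in degrees at least two *)

Definition extension_index (G : digraph) n D :=
  forall (f : {additive Omega G n.+1 -> int})
    (h : {additive Omega G n -> int}) m,
    (0 < m)%N -> (forall x, f x *+ m = h (Omega_boundary x)) ->
  exists h' : {additive Omega G n -> int},
    forall x, f x *+ D = h' (Omega_boundary x).

Section LongPaths.
Variables (G : digraph) (n : nat) (W : {set G}).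
Hypothesis suppW : forall (x : rchain G n.+2) v,
  x \in @in_Omega G n.+2 -> x v != 0 -> all [in W] (val v).

(** By [suppW] these paths carry all of Omega in degree [n.+2]. Their faces are indexed by [inner],
    which retains forbidden paths, since the boundary has to vanish on those. *)
Definition inner_allowed (v : rpath G n.+2) :=
  all [in W] (val v) && allowed_path v.
Definition inner (w : rpath G n.+1) := all [in W] (val w).

Local Notation t := #|{: {v | inner_allowed v}}|.
Local Notation s := #|{: {w | inner w}}|.

Local Notation row_path i := (val (enum_val i : {v | inner_allowed v})).
Local Notation col_path j := (val (enum_val j : {w | inner w})).

Definition boundary_mx : 'M[int]_(t, s) :=
  \matrix_(i, j) incidence (val (row_path i)) (val (col_path j)).

(** Zeroing the columns of allowed faces leaves the equations that cut out Omega, which becomes a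
    left kernel. *)
Definition forbidden_boundary_mx : 'M[int]_(t, s) :=
  \matrix_(i, j) (boundary_mx i j *+ ~~ allowed_path (col_path j)).

Lemma incidence_out (v : rpath G n.+2) (w : rpath G n.+1) :
  all [in W] (val v) -> ~~ inner w -> incidence (val v) (val w) = 0.
Proof.
move=> vW; apply: contraNeq => inc; apply: contraT => Nw; move/eqP: inc; case.
rewrite /incidence big1 // => i _; case: eqP => // fw.
case/negP: Nw; rewrite /inner -fw; apply/allP => z.
by rewrite mem_cat => /orP[/mem_take|/mem_drop]; apply: (allP vW).
Qed.

Lemma boundary_ext0 (y : 'rV_t) :
  @boundary G n.+1 (ext0 y) = ext0 (y *m boundary_mx).
Proof.
apply/ffunP => w; rewrite ffunE sum_ext0; have [Pw|Nw] := boolP (inner w).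
  pose r : {w | inner w} := exist _ w Pw.
  rewrite -[w]/(val r) -[r]enum_rankK ext0_val mxE.
  by apply: eq_bigr => i _; rewrite mxE mulrC.
rewrite ext0_out // big1 // => i _; rewrite incidence_out ?mul0r //.
by have /andP[] := valP (enum_val i).
Qed.

Lemma ext0_in_Omega (y : 'rV_t) :
  (ext0 y \in @in_Omega G n.+2) = (y *m forbidden_boundary_mx == 0).
Proof.
have yN j : (y *m forbidden_boundary_mx) 0 j =
    (y *m boundary_mx) 0 j *+ ~~ allowed_path (col_path j).
  by rewrite !mxE -sumrMnl; apply: eq_bigr => i _; rewrite !mxE mulrnAr.
have y_al : ext0 y \in @allowed G n.+2.
  apply/forallP => v; apply/implyP; apply: contraR => Nv.
  by rewrite ext0_out // negb_and Nv orbT.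
rewrite [LHS]unfold_in /= y_al boundary_ext0 /=.
apply/forallP/eqP => [bx_al|yN0 w].
  apply/rowP => j; rewrite yN [RHS]mxE; have := bx_al (col_path j).
  rewrite ext0_val; case: (allowed_path _) => /=.
    by rewrite mulr0n.
  by rewrite implybF negbK => /eqP->.
apply/implyP; apply: contraR => Nw; have [Pw|/ext0_out->//] := boolP (inner w).
move/rowP/(_ (enum_rank (exist _ w Pw : {w | inner w}))): yN0.
by rewrite yN [X in _ = X]mxE -ext0_val enum_rankK /= Nw mulr1n => ->.
Qed.

(** The rows of [K] are elements [k i] of Omega, and [h'] weights the values [f (k i)] by the
    coordinates of its argument times [P]. For [x] in Omega, the matrix identity makes [D] times the
    boundary of [x] the boundary of a combination [X] of the [k i]. Applying [h] shows that [m]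
    times [D f(x)] is [m] times [f(X)], and [m] cancels. *)
Lemma extension_index_long D :
  extends_after boundary_mx forbidden_boundary_mx D -> extension_index G n.+1 D.
Proof.
move=> [K [P [KN0 DE]]] f h m m_gt0 fh.
have K_Om i : ext0 (row i K) \in @in_Omega G n.+2.
  by rewrite ext0_in_Omega -row_mul KN0 row0.
pose k i : Omega G n.+2 := Sub (ext0 (row i K)) (K_Om i).
pose g (z : Omega G n.+1) := \sum_i f (k i) * (restrict inner (val z) *m P) 0 i.
have g_add : zmod_morphism g.
  move=> z1 z2; rewrite /g -sumrB; apply: eq_bigr => i _; rewrite -mulrBr.
  have -> : restrict inner (val (z1 - z2)) =
      restrict inner (val z1) - restrict inner (val z2).
    by apply/rowP => j; rewrite !mxE raddfB !ffunE.
  by rewrite mulmxBl [X in _ * X = _]mxE [X in _ * (_ + X) = _]mxE.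
pose h' : {additive Omega G n.+1 -> int} :=
  HB.pack g (GRing.isZmodMorphism.Build _ _ g g_add).
exists h' => x; rewrite /= /g.
have x_Om := valP x.
have xK : ext0 (restrict inner_allowed (val x)) = val x.
  apply: restrictK => v xv; rewrite /inner_allowed (suppW x_Om xv).
  by have /andP[/forallP/(_ v)/implyP->] := x_Om.
set y := restrict inner_allowed (val x) in xK.
have yN0 : y *m forbidden_boundary_mx = 0.
  by apply/eqP; rewrite -ext0_in_Omega xK.
have bE : val (Omega_boundary x) = ext0 (y *m boundary_mx).
  by rewrite -boundary_ext0 xK.
rewrite bE ext0K; set c := y *m boundary_mx *m P.
pose X : Omega G n.+2 := \sum_i k i *~ c 0 i.
have valX : val X = ext0 (c *m K).
  rewrite mulmx_sum_row !raddf_sum /=; apply: eq_bigr => i _.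
  by rewrite -[LHS]/(val (k i *~ c 0 i)) raddfMz -[c 0 i in RHS]intz
    scaler_int raddfMz.
have XE : Omega_boundary X = Omega_boundary x *+ D.
  apply: val_inj; rewrite -[LHS]/(boundary (val X)) valX boundary_ext0 -DE //.
  have -> : val (Omega_boundary x *+ D) = val (Omega_boundary x) *+ D.
    exact: raddfMn.
  by rewrite bE -natz scaler_nat raddfMn.
apply/eqP; rewrite -(eqr_pMn2r m_gt0) mulrnAC fh -raddfMn -XE -fh.
rewrite raddf_sum /=; apply/eqP; congr (_ *+ _); apply: eq_bigr => i _.
by rewrite raddfMz -mulrzz.
Qed.

End LongPaths.

Lemma extension_index_uniform g n : exists2 D, (0 < D)%N &
  forall G : digraph, genus G = g -> extension_index G n.+1 D.
Proof.
(* A path of degree [n.+2] has [n.+3] vertices, hence [n.+3] faces: the first number bounds the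
   count of words in at most [8 * g] letters, the second the matrix entries. *)
have [D D_gt0 DP] := extends_after_bounded ((8 * g).+1 ^ n.+3) n.+3.
exists D => // G gG; apply: (extension_index_long (@support_short G n)).
have W_le : (#|short_vertices G| <= 8 * g)%N by rewrite -gG card_short_vertices.
have entry i j : `|@boundary_mx G n (short_vertices G) i j| <= n.+3%:Z :> int.
  by rewrite mxE (le_trans (incidence_bound _ _)) // size_tuple.
have inner_le : (#|{: {w | @inner G n (short_vertices G) w}}| <=
    (8 * g).+1 ^ n.+3)%N.
  apply: leq_trans (card_words W_le _) _; first by [].
  by rewrite leq_pexp2l.
apply: DP => //.
- by apply: card_words W_le _ => v /andP[].
- move=> i j; rewrite mxE; case: (~~ _); first exact: entry.
  by rewrite mulr0n normr0.
Qed.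

(** * Degree one: dividing a potential *)

Section DegreeOne.
Variable G : digraph.

Definition vertex_path (a : G) : rpath G 0 := exist _ [tuple a] isT.

Lemma sum_incidence_edge (u : rpath G 1) : exists a b,
  val u = [:: a; b] :> seq G /\
  forall q : rpath G 0 -> int,
    \sum_(v : rpath G 0) incidence (val u) (val v) * q v =
    q (vertex_path b) - q (vertex_path a).
Proof.
case: u => [[[|a [|b []]] //= sz] u_reg]; exists a, b; split=> //= q.
pose c (x : G) := fun v : rpath G 0 => (v == vertex_path x)%:Z.
have inc (v : rpath G 0) : incidence [:: a; b] (val v) = c b v - c a v.
  rewrite /incidence !big_ord_recl big_ord0 /= /face /=.
  rewrite /c -!val_eqE /= ![[:: _] == _]eq_sym. by do 2!case: (_ == _).
have sum_c x : \sum_(v : rpath G 0) c x v * q v = q (vertex_path x).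
  rewrite (bigD1 (vertex_path x)) //= /c eqxx mul1r big1 ?addr0 // => v.
  by move=> /negPf->; rewrite mul0r.
under eq_bigr do rewrite inc mulrBl.
by rewrite sumrB !sum_c.
Qed.

Definition basis_chain n (v : rpath G n) : rchain G n :=
  [ffun u => (u == v)%:Z].

Lemma boundary_basis_chain n (u : rpath G n.+1) (v : rpath G n) :
  boundary (basis_chain u) v = incidence (val u) (val v).
Proof.
rewrite ffunE (bigD1 u) //= big1 => [|w /negPf ne_w]; rewrite !ffunE.
  by rewrite eqxx mulr1 addr0.
by rewrite ne_w mulr0.
Qed.

Lemma allowed0 (x : rchain G 0) : x \in @allowed G 0.
Proof.
by apply/forallP => -[[[|a []] //= sz] v_reg]; apply: implybT.
Qed.

(** The faces of an arc are single vertices, and these are always allowed. *)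
Lemma basis_chain_in_Omega1 (u : rpath G 1) :
  allowed_path u -> basis_chain u \in @in_Omega G 1.
Proof.
move=> u_al; rewrite unfold_in /= allowed0 andbT; apply/forallP => v.
by rewrite ffunE; case: (eqVneq v u) => [->|//]; rewrite u_al implybT.
Qed.

(* A potential h whose differences along edges are divisible by m can be divided
   by m, by rounding each of its values down. *)
Lemma extension_index_degree1 : extension_index G 0 1.
Proof.
move=> f h m m_gt0 fh.
pose e v : Omega G 0 := Sub (basis_chain v) (allowed0 _).
(* Omega in degree 0 is free on the vertices, so [h] is a potential with values [h (e v)]. *)
have hE z : h z = \sum_(v : rpath G 0) val z v * h (e v).
  have eE v c u : val (e v *~ c) u = (u == v)%:Z * c.
    rewrite raddfMz /=; case: c => c; rewrite /intmul ?ffunE ffunMnE ffunE.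
      by rewrite -mulr_natr natz.
    by rewrite -mulr_natr natz NegzE mulrN.
  have {1}-> : z = \sum_(v : rpath G 0) e v *~ val z v.
    apply: val_inj; rewrite raddf_sum; apply/ffunP => u.
    rewrite sum_ffunE (bigD1 u) //= big1 => [|v ne_v].
      by rewrite addr0 eE eqxx mul1r.
    by rewrite eE eq_sym (negPf ne_v) mul0r.
  by rewrite raddf_sum; apply: eq_bigr => v _; rewrite raddfMz mulrzz mulrC.
pose g (z : Omega G 0) := \sum_(v : rpath G 0) val z v * (h (e v) %/ m%:Z)%Z.
have g_add : zmod_morphism g.
  move=> z1 z2; rewrite /g -sumrB; apply: eq_bigr => v _; rewrite -mulrBl.
  by rewrite raddfB !ffunE.
pose h' : {additive Omega G 0 -> int} :=
  HB.pack g (GRing.isZmodMorphism.Build _ _ g g_add).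
exists h' => x; rewrite mulr1n /= /g.
apply/eqP; rewrite -(eqr_pMn2r m_gt0) fh hE; apply/eqP.
rewrite -[RHS]mulr_natr mulr_suml; apply/eqP.
rewrite -subr_eq0 -sumrB; apply/eqP.
(* What remains after rounding are the remainders modulo [m]. Regrouped by arcs, each arc
   contributes a multiple of the difference of the remainders at its ends. *)
have -> : \sum_(v : rpath G 0) (val (Omega_boundary x) v * h (e v) -
    val (Omega_boundary x) v * (h (e v) %/ m)%Z * m%:R) =
  \sum_(v : rpath G 0) \sum_(u : rpath G 1)
     incidence (val u) (val v) * val x u * (h (e v) %% m)%Z.
  apply: eq_bigr => v _; rewrite -mulr_suml /= ffunE -mulrA -mulrBr.
  congr (_ * _).
  by rewrite /modz natz.
rewrite exchange_big big1 //= => u _.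
under eq_bigr do rewrite mulrAC.
rewrite -mulr_suml; have [a [b [uE uS]]] := sum_incidence_edge u.
rewrite uS; have [->|xu] := eqVneq (val x u) 0; first by rewrite mulr0.
have /andP[/forallP/(_ u)/implyP/(_ xu) u_al _] := valP x.
(* On a single allowed arc the hypothesis says that the values of [h] at its ends differ by a
   multiple of [m], so the remainders agree. *)
have := fh (Sub (basis_chain u) (basis_chain_in_Omega1 u_al)).
rewrite hE; under eq_bigr do rewrite /= boundary_basis_chain.
rewrite uS => fE.
suff -> : (h (e (vertex_path b)) %% m)%Z = (h (e (vertex_path a)) %% m)%Z.
  by rewrite subrr mul0r.
apply/eqP; rewrite eqz_mod_dvd -fE -mulr_natr natz; exact: dvdz_mull.
Qed.

End DegreeOne.

(** * From cochains to the exponent of the torsion *)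

Lemma torsion_exponent_bound (G : digraph) n D :
    (0 < D)%N -> extension_index G n D ->
  exists2 e : nat,
    is_exponent (@torsion (path_cohomology G n.+1)) e & (e <= D)%N.
Proof.
move=> D_gt0 DP; pose A := path_cohomology G n.+1.
pose kills m := (0 < m)%N /\ forall a : A, torsion a -> a *+ m = 0.
have killsD : kills D.
  (* For a representative [c] of a torsion class, some [c *+ m] is a coboundary; [extension_index]
     then makes [c *+ D] one. *)
  split=> // a; rewrite -[a]reprK; set c := repr a => -[m m_gt0].
  have pi0 (z : cocycle G n.+1) :
      (\pi_A z = 0) <-> (z \in @is_coboundary G n.+1).
    rewrite -[z in z \in _]subr0 Quotient.idealrBE -(raddf0 (\pi_A)).
    by split=> /eqP.
  have additive_of p (u : cochain G p) :
      {f : {additive Omega G p -> int} | f =1 val u}.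
    have /asboolP u_add := valP u.
    by exists (HB.pack_for {additive Omega G p -> int} (val u)
      (GRing.isZmodMorphism.Build _ _ (val u) u_add)).
  have valMn q x : val (val (c *+ q)) x = val (val c) x *+ q.
    by rewrite !raddfMn /=; elim: q => [|q IHq]; rewrite ?mulr0n // !mulrS -IHq.
  rewrite -!raddfMn => /pi0/asboolP[h hE]; apply/pi0/asboolP.
  have [f fE] := additive_of _ (val c); have [h1 h1E] := additive_of _ h.
  have [|h' h'E] := DP f h1 m m_gt0.
    by move=> x; rewrite fE h1E -valMn -hE.
  have h'_add : (h' : Omega G n -> int) \in @is_additive G n.
    by apply/asboolP; apply: raddfB.
  exists (Sub (h' : Omega G n -> int) h'_add); apply: val_inj.
  apply/funext => x.
  by rewrite valMn -fE h'E.
(* The exponent is the least positive integer killing the torsion; [D] shows that there is one. *)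
have ex_kills : exists m, `[< kills m >] by exists D; apply/asboolP.
case: (ex_minnP ex_kills) => e /asboolP e_kills e_min.
exists e; last by apply: e_min; apply/asboolP.
by split=> // m m_kills; apply: e_min; apply/asboolP.
Qed.

Theorem corollary5p11 :
  forall g k : nat, (0 < g)%N -> (0 < k)%N ->
  exists d : nat, forall G : digraph, genus G = g ->
  exists2 e : nat, is_exponent (@torsion (path_cohomology G k)) e & (e <= d)%N.
Proof.
move=> g [//|[|n]] _ _.
  (* Degree 1 has no torsion, so the bound is 1 for every genus. *)
  by exists 1%N => G _; apply/torsion_exponent_bound/extension_index_degree1.
have [D D_gt0 DP] := extension_index_uniform g n.
by exists D => G /DP; apply: torsion_exponent_bound.
Qed.
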